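(* For all integers $n\ge 1$ and $k\ge 0$, $$\sum_{p} N_O(n,k,p)=\sum_{p} N_E(n,k,p)=2^{k+1}\binom{2n-k-2}{n-1},$$ where the sums are over all integers $p$.
   Context: A lattice path of length $n$ here is a path in the plane starting at the origin $(0,0)$ and consisting of $n$ unit steps, each either E $=(1,0)$ or N $=(0,1)$. For integers $n\ge 1$, $k\ge 0$, $r$, $s$, let $M_{r,s}^{n,k}$ be the number of ordered pairs of lattice paths of length $n$ such that the first path ends at $(r,n-r)$, the second path ends at $(s,n-s)$, and the two paths intersect exactly $k$ times, where intersections at the origin and at the endpoints of the paths are not counted; that is, there are exactly $k$ indices $m$ with $1\le m\le n-1$ such that the two paths are at the same lattice point after $m$ steps. ($M_{r,s}^{n,k}=0$ unless $0\le r,s\le n$.) For an integer $p$ define $$N_E(n,k,p)=\sum_{r+s=2p} M_{r,s}^{n,k},\qquad N_O(n,k,p)=\sum_{r+s=2p+1} M_{r,s}^{n,k},$$ where the sums are over all ordered pairs of integers $(r,s)$ with $0\le r,s\le n$ and the indicated value of $r+s$. (Only finitely many $p$ give nonzero values.) Binomial coefficients $\binom{a}{b}$ are $0$ unless $0\le b\le a$ (in particular they are $0$ when $a<0$). *)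

(* Defs.v *)
From mathcomp Require Import all_boot all_order all_algebra.
From mathcomp Require Import zify.
From mathcomp Require Import classical_sets cardinality fsbigop.

Set Implicit Arguments.
Unset Strict Implicit.
Unset Printing Implicit Defensive.

Import Order.TTheory GRing.Theory Num.Theory.
Local Open Scope ring_scope.

(* A lattice path of length n is encoded by its steps: true is E, false is N. *)
Definition lattice_path (n : nat) := n.-tuple bool.

Definition step_vector (b : bool) : int * int := if b then (1, 0) else (0, 1).

Definition point_after (n : nat) (w : lattice_path n) (m : nat) : int * int :=
  \sum_(b <- take m w) step_vector b.

(* The origin (m = 0) and the endpoints (m = n) are not counted; 'I_n already
   excludes m = n. *)
Definition nb_intersections (n : nat) (u v : lattice_path n) : nat :=
  #|[set m : 'I_n | (0 < m)%N && (point_after u m == point_after v m)]|.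

Definition M (n k : nat) (r s : int) : nat :=
  #|[set uv : n.-tuple bool * n.-tuple bool |
      [&& point_after uv.1 n == (r, n%:Z - r),
          point_after uv.2 n == (s, n%:Z - s)
        & nb_intersections uv.1 uv.2 == k]]|.

Definition N_E (n k : nat) (p : int) : nat :=
  (\sum_(r < n.+1) \sum_(s < n.+1 | (r%:Z + s%:Z == 2 * p)%R) M n k r%:Z s%:Z)%N.

Definition N_O (n k : nat) (p : int) : nat :=
  (\sum_(r < n.+1) \sum_(s < n.+1 | (r%:Z + s%:Z == 2 * p + 1)%R)
     M n k r%:Z s%:Z)%N.

(* The upper argument must be an integer: with truncated subtraction,
   2n - k - 2 would become 0 and give a spurious 1 when n = 1 and k > 0. *)
Definition binz (a b : int) : nat :=
  match a, b with
  | Posz i, Posz j => 'C(i, j)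
  | _, _ => 0%N
  end.

(* [\sum_(p \in setT) F p] has value 0 when F has infinite support; the two
   families summed over all integers are finitely supported. *)
Lemma finite_support_int (n : nat) (F : int -> nat) :
  (forall p, F p != 0%N -> (0 <= p) && (p <= n%:Z)) ->
  finite_set [set p | F p != 0%N]%classic.
Proof.
move=> hF; apply: (@sub_finite_set _ _ (Posz @` `I_n.+1)%classic); last first.
  exact/finite_image/finite_II.
move=> p /= /hF /andP[p_ge0 p_le].
by exists `|p|%N; [rewrite /=; lia | exact: gez0_abs].
Qed.

Lemma N_E_finite_support (n k : nat) :
  finite_set [set p | N_E n k p != 0%N]%classic.
Proof.
apply: (@finite_support_int n) => p; rewrite /N_E; apply: contraR => hp.
rewrite big1 // => r _; rewrite big_pred0 // => s.
apply/negbTE; apply: contra hp => /eqP; move: (ltn_ord r) (ltn_ord s).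
lia.
Qed.

Lemma N_O_finite_support (n k : nat) :
  finite_set [set p | N_O n k p != 0%N]%classic.
Proof.
apply: (@finite_support_int n) => p; rewrite /N_O; apply: contraR => hp.
rewrite big1 // => r _; rewrite big_pred0 // => s.
apply/negbTE; apply: contra hp => /eqP; move: (ltn_ord r) (ltn_ord s).
lia.
Qed.

(* Main.v *)
(* The difference d of the abscissae of the two paths is a lazy walk on the
   integers, and the paths meet when it vanishes.  Counting the pairs started at
   an arbitrary d, with k meetings and a prescribed parity of r + s, gives by
   conditioning on the first steps a recurrence in n whose solution is explicit
   and does not depend on the parity; the theorem is the case d = 0. *)

Require Import Defs.
From mathcomp Require Import all_boot all_order all_algebra.
From mathcomp Require Import classical_sets cardinality fsbigop.
From mathcomp Require Import zify.

Import Order.TTheory GRing.Theory Num.Theory.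

(** * The closed formula and its recurrences *)

(* Half the number of pairs of paths of length m.+1 whose abscissae initially
   differ by e, with k meetings at times 0, ..., m, in either parity class.  One
   step of the pair acts as two half-steps of a simple walk, whence m.*2.  For
   k = 0 the increments in e come from the reflection principle.  The guard j <= m is
   needed because 'C(m.*2 - j, m + e) would be 1 at m = e = 0 < j. *)
Definition meeting_formula (m e k : nat) : nat :=
  if k is j.+1 then (if j <= m then 2 ^ j * 'C(m.*2 - j, m + e) else 0)
  else \sum_(i < e) 'C(m.*2.+1, m.+1 + i).

Lemma binSS (n m : nat) :
  'C(n.+2, m.+2) = 'C(n, m) + 2 * 'C(n, m.+1) + 'C(n, m.+2).
Proof. by rewrite !binS; lia. Qed.

Lemma bin_central (m : nat) : 'C(m.*2.+1, m) = 'C(m.*2.+1, m.+1).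
Proof. by rewrite -[LHS]bin_sub; [congr 'C(_, _) |]; lia. Qed.

Lemma meeting_formula0 (e k : nat) :
  meeting_formula 0 e k = (k == (e == 0)).
Proof.
case: k => [|[|j]] /=; last by case: e.
- case: e => [|e]; first by rewrite big_ord0.
  by rewrite big_ord_recl big1 // => i _; rewrite bin_small.
- by case: e.
Qed.

(** Off zero, one pair of steps lowers or raises the distance in one way each and keeps it in two;
    as two half-steps, this is Pascal's rule applied twice. *)
Lemma meeting_formulaS (m e k : nat) :
  meeting_formula m.+1 e.+1 k =
  meeting_formula m e k + 2 * meeting_formula m e.+1 k
  + meeting_formula m e.+2 k.
Proof.
case: k => [|j] /=.
  elim: e => [|e IHe].
    rewrite !big_ord_recr !big_ord0 /= !addn0 !addn1 doubleS.
    (* By symmetry, ['C(m.*2.+1, m)] is the third copy of ['C(m.*2.+1, m.+1)] needed on the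
       right. *)
    by rewrite binSS bin_central; lia.
  (* Raising [e] adds one binomial to each sum, and the added terms satisfy [binSS]. *)
  rewrite big_ord_recr /= IHe.
  rewrite [in RHS]big_ord_recr [in X in _ = _ + X + _]big_ord_recr
          [in X in _ = _ + X]big_ord_recr /=.
  have -> : m.+2 + e.+1 = (m.+1 + e).+2 by lia.
  have -> : m.+1 + e.+1 = (m.+1 + e).+1 by lia.
  have -> : m.+1 + e.+2 = (m.+1 + e).+2 by lia.
  by rewrite doubleS binSS; lia.
case: (leqP j m) => hj.
  rewrite leqW //.
  have -> : m.+1.*2 - j = (m.*2 - j).+2 by lia.
  have -> : m.+1 + e.+1 = (m + e).+2 by lia.
  by rewrite binSS !addnS 2!mulnDr (mulnCA _ 2).
(* Only [j = m.+1] remains: the guards kill the right side, and the upper index [m.+1] on the left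
   is below the lower one. *)
case: ifP => // _.
by rewrite bin_small ?muln0 //; lia.
Qed.

(** From difference 0, time 0 uses up one meeting, and the differences 1 and -1 contribute equally,
    whence the second factor 2. *)
Lemma meeting_formulaS0 (m k : nat) :
  meeting_formula m.+1 0 k.+1 =
  2 * meeting_formula m 0 k + 2 * meeting_formula m 1 k.
Proof.
case: k => [|j] /=.
  rewrite big_ord0 big_ord1 subn0 !addn0 expn0 doubleS binS bin_central.
  by lia.
rewrite ltnS; case: leqP => // hj.
have -> : m.+1.*2 - j.+1 = (m.*2 - j).+1 by lia.
by rewrite !addn0 addn1 binS expnS; lia.
Qed.

(** * Counting pairs by conditioning on the first steps *)

(* Time 0 is counted and time n is not, which makes the last step free. *)
Definition meetings (n : nat) (d : int) (u v : seq bool) : nat :=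
  \sum_(m < n) (d + (count id (take m u))%:Z == (count id (take m v))%:Z)%R.

Lemma meetings_cons (n : nat) (d : int) (a b : bool) (u v : seq bool) :
  meetings n.+1 d (a :: u) (b :: v) =
  (d == 0%R) + meetings n (d + a%:Z - b%:Z)%R u v.
Proof.
rewrite /meetings big_ord_recl /= addr0; congr addn.
by apply: eq_bigr => i _; rewrite add0n; congr nat_of_bool; lia.
Qed.

Definition meeting_pairs (n : nat) (d : int) (k : nat) (odd_sum : bool) : nat :=
  \sum_(u : n.-tuple bool) \sum_(v : n.-tuple bool)
    ((meetings n d u v == k) && (odd (count id u + count id v) == odd_sum)).

Lemma sum_tuple_cons (T : finType) (n : nat) (F : n.+1.-tuple T -> nat) :
  \sum_u F u = \sum_a \sum_(u : n.-tuple T) F [tuple of a :: u].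
Proof.
rewrite pair_big /=.
rewrite (reindex (fun p : T * n.-tuple T => [tuple of p.1 :: p.2])) //=.
exists (fun u => (thead u, [tuple of behead u])) => [[a u] _ | u _] /=.
  by congr pair; apply: val_inj.
by rewrite -tuple_eta.
Qed.

(** Writing the count as [(d == 0%R) + k] covers both cases of a meeting at time 0 without
    subtraction. *)
Lemma meeting_pairs_cons (n : nat) (d : int) (k : nat) (odd_sum : bool) :
  meeting_pairs n.+1 d ((d == 0%R) + k) odd_sum =
  \sum_(a : bool) \sum_(b : bool)
    meeting_pairs n (d + a%:Z - b%:Z)%R k (odd_sum (+) a (+) b).
Proof.
rewrite /meeting_pairs sum_tuple_cons; apply: eq_bigr => a _.
under eq_bigr do rewrite sum_tuple_cons.
rewrite exchange_big /=; apply: eq_bigr => b _.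
apply: eq_bigr => u _; apply: eq_bigr => v _.
rewrite meetings_cons eqn_add2l; congr (nat_of_bool (_ && _)).
rewrite /= !oddD !oddb.
by case: a b odd_sum (odd _) (odd _) => [] [] [] [] [].
Qed.

Lemma meeting_pairs00 (n : nat) (odd_sum : bool) :
  meeting_pairs n.+1 0 0 odd_sum = 0.
Proof.
rewrite /meeting_pairs sum_tuple_cons big1 // => a _; rewrite big1 // => u _.
rewrite sum_tuple_cons big1 // => b _; rewrite big1 // => v _.
by rewrite meetings_cons.
Qed.

Lemma meeting_pairs0 (d : int) (k : nat) (odd_sum : bool) :
  meeting_pairs 0 d k odd_sum = (k == 0) && ~~ odd_sum.
Proof.
rewrite /meeting_pairs !(big_pred1 [tuple]) => [| u | u]; last 2 first.
- by rewrite [u]tuple0 /= eqxx.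
- by rewrite [u]tuple0 /= eqxx.
by rewrite /meetings big_ord0 /= eq_sym; case: odd_sum.
Qed.

(** The induction starts at length 1: the empty pair is even, whereas a free last step splits the
    pairs evenly between the parities. *)
Lemma meeting_pairsE (n : nat) (d : int) (k : nat) (odd_sum : bool) :
  meeting_pairs n.+1 d k odd_sum = 2 * meeting_formula n `|d|%N k.
Proof.
elim: n d k odd_sum => [|n IHn] d k odd_sum.
  case: (eqVneq d 0%R) => [->|d_neq0].
    case: k => [|k]; first by rewrite meeting_pairs00 meeting_formula0.
    have := @meeting_pairs_cons 0 0%R k odd_sum; rewrite add1n => ->.
    rewrite !big_bool !meeting_pairs0 meeting_formula0.
    by case: odd_sum k => [] [].
  have := @meeting_pairs_cons 0 d k odd_sum.
  rewrite (negbTE d_neq0) add0n => ->.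
  rewrite !big_bool !meeting_pairs0 meeting_formula0 absz_eq0 (negbTE d_neq0).
  by case: odd_sum (k == 0) => [] [].
case: (eqVneq d 0%R) => [->|d_neq0].
  case: k => [|k]; first by rewrite meeting_pairs00 /= big_ord0.
  have := @meeting_pairs_cons n.+1 0%R k odd_sum; rewrite add1n => ->.
  rewrite !big_bool !IHn -[absz 0%R]/0%N meeting_formulaS0 /=.
  by rewrite !addn0 add0n subnn; lia.
have := @meeting_pairs_cons n.+1 d k odd_sum.
rewrite (negbTE d_neq0) add0n => ->; rewrite !big_bool !IHn /=.
have [e de] : exists e, `|d|%N = e.+1 by exists `|d|.-1; lia.
rewrite de meeting_formulaS.
have -> : `|(d + 1%:Z - 1%:Z)%R|%N = e.+1 by lia.
have -> : `|(d + 0%:Z - 0%:Z)%R|%N = e.+1 by lia.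
case: (ltrP 0 d) => hd.
  have -> : `|(d + 1%:Z - 0%:Z)%R|%N = e.+2 by lia.
  have -> : `|(d + 0%:Z - 1%:Z)%R|%N = e by lia.
  by lia.
have -> : `|(d + 1%:Z - 0%:Z)%R|%N = e by lia.
have -> : `|(d + 0%:Z - 1%:Z)%R|%N = e.+2 by lia.
by lia.
Qed.

(** * From lattice points to numbers of E steps *)

Lemma sum_step_vector (s : seq bool) :
  (\sum_(b <- s) step_vector b)%R
  = ((count id s)%:Z, (size s)%:Z - (count id s)%:Z)%R.
Proof.
elim: s => [|b s IHs]; first by rewrite big_nil.
rewrite big_cons IHs /step_vector; case: b => /=;
  by congr pair; rewrite /=; lia.
Qed.

Lemma point_afterE (n : nat) (w : lattice_path n) (m : nat) : m <= n ->
  point_after w m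
  = ((count id (take m w))%:Z, m%:Z - (count id (take m w))%:Z)%R.
Proof.
by move=> hm; rewrite /point_after sum_step_vector size_takel ?size_tuple.
Qed.

(** The successor accounts for time 0, counted only by [meetings]. Abscissae suffice, since after
    [m] steps the coordinates sum to [m]. *)
Lemma nb_intersectionsE (n : nat) (u v : lattice_path n.+1) :
  (nb_intersections u v).+1 = meetings n.+1 0 u v.
Proof.
rewrite /meetings /nb_intersections -sum1dep_card big_mkcond !big_ord_recl /=.
rewrite !take0 add0n eqxx add1n; congr S; apply: eq_bigr => i _.
have hi : bump 0 i <= n.+1 by rewrite /bump; have := ltn_ord i; lia.
rewrite !point_afterE // xpair_eqE add0r /=.
by rewrite /bump /=; case: eqP => [->|] //=; rewrite eqxx.
Qed.

(** * Summation over endpoints and over [p] *)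

Lemma M_E (n k r s : nat) :
  M n k r%:Z%R s%:Z%R =
  \sum_(uv : n.-tuple bool * n.-tuple bool)
    [&& count id uv.1 == r, count id uv.2 == s
      & nb_intersections uv.1 uv.2 == k].
Proof.
rewrite /M -sum1dep_card big_mkcond; apply: eq_bigr => [[u v]] _ /=.
rewrite !point_afterE // !take_oversize ?size_tuple // !xpair_eqE.
have endE (a b : nat) : ((a%:Z == b%:Z) && (n%:Z - a%:Z == n%:Z - b%:Z))%R
  = (a == b) by apply/andP/eqP; [case|split]; lia.
by rewrite !endE; case: ifP.
Qed.

Lemma sum_M_endpoints (n k : nat) (P : rel nat) :
  \sum_(r < n.+1) \sum_(s < n.+1 | P r s) M n k r%:Z%R s%:Z%R =
  \sum_(uv : n.-tuple bool * n.-tuple bool)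
    (P (count id uv.1) (count id uv.2) && (nb_intersections uv.1 uv.2 == k)).
Proof.
under eq_bigr do under eq_bigr do rewrite M_E.
rewrite pair_big_dep exchange_big /=; apply: eq_bigr => [[u v]] _ /=.
have hu : count id u < n.+1 by rewrite ltnS -[leqRHS](size_tuple u) count_size.
have hv : count id v < n.+1 by rewrite ltnS -[leqRHS](size_tuple v) count_size.
rewrite big_mkcond (bigD1 (Ordinal hu, Ordinal hv)) //= !eqxx /= big1 ?addn0.
  by case: (P _ _).
case=> r s; rewrite xpair_eqE /= -!val_eqE /= => hrs.
case: ifP => // _; rewrite (eq_sym (count id u)) (eq_sym (count id v)).
by move: hrs; do 2!case: eqP => //=.
Qed.

(** Only [p = a./2] can contribute, and the bound on [a] keeps it in range. *)
Lemma sum_eq_double (c : bool) (n a : nat) : a <= n.*2.+1 ->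
  \sum_(p < n.+1) (a%:Z == 2 * p%:Z + c%:Z)%R = (odd a == c).
Proof.
move=> ha; case: eqP => hc.
  have hp : a./2 < n.+1 by lia.
  rewrite (bigD1 (Ordinal hp)) //= big1 ?addn0.
    by case: eqP => //; case: c hc => /= hc; lia.
  move=> p; rewrite -val_eqE /= => hpa.
  by case: eqP => //; case: c hc => /= hc; lia.
by rewrite big1 // => p _; case: eqP => //; case: c hc => /= hc; lia.
Qed.

Lemma sum_M_parity (c : bool) (n k : nat) :
  (\sum_(p \in [set: int])
    (\sum_(r < n.+1) \sum_(s < n.+1 | (r%:Z + s%:Z == 2 * p + c%:Z)%R)
       M n k r%:Z%R s%:Z%R)%N)%R =
  \sum_(uv : n.-tuple bool * n.-tuple bool)
    ((odd (count id uv.1 + count id uv.2) == c)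
     && (nb_intersections uv.1 uv.2 == k)).
Proof.
(* Since [r + s] lies between 0 and [n.*2], only [p] from 0 to [n] contribute. *)
rewrite (fsbigE [seq Posz p | p <- iota 0 n.+1]).
- rewrite big_map -/(index_iota 0 n.+1) big_mkord.
  under eq_bigl do rewrite in_setT.
  under eq_bigr => p _ do rewrite
    (@sum_M_endpoints n k (fun r s => (r%:Z + s%:Z == 2 * p%:Z + c%:Z)%R)).
  rewrite exchange_big /=; apply: eq_bigr => [[u v]] _ /=.
  have cu : count id u <= n by rewrite -[leqRHS](size_tuple u) count_size.
  have cv : count id v <= n by rewrite -[leqRHS](size_tuple v) count_size.
  under eq_bigr do rewrite -mulnb.
  rewrite -big_distrl /= -PoszD sum_eq_double; last by lia.
  by case: (_ == c); case: (_ == k).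
- by rewrite map_inj_uniq ?iota_uniq // => x y [].
- by [].
- move=> p _ hp; rewrite big1 // => r _; rewrite big_pred0 // => s.
  apply/negbTE; apply: contra hp => /eqP hrs.
  apply/mapP; exists `|p|%N; rewrite ?mem_iota; move: (ltn_ord r) (ltn_ord s);
    case: c hrs => /=; lia.
Qed.

Local Open Scope ring_scope.
Local Open Scope classical_set_scope.

Theorem theorem3 (n k : nat) (hn : (1 <= n)%N) :
  \sum_(p \in [set: int]) N_O n k p = \sum_(p \in [set: int]) N_E n k p /\
  \sum_(p \in [set: int]) N_E n k p
    = (2 ^ k.+1 * binz (2 * n%:Z - k%:Z - 2) (n%:Z - 1))%N.
Proof.
case: n hn => // n _.
have parityE (c : bool) :
    (\sum_(uv : n.+1.-tuple bool * n.+1.-tuple bool)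
      ((odd (count id uv.1 + count id uv.2) == c)
       && (nb_intersections uv.1 uv.2 == k)))%N
    = (2 * meeting_formula n 0 k.+1)%N.
  rewrite -[0%N]/`|0%Z|%N -(meeting_pairsE _ _ _ c) /meeting_pairs pair_big.
  by apply: eq_bigr => uv _; rewrite -nb_intersectionsE eqSS andbC.
have NO : \sum_(p \in [set: int]) N_O n.+1 k p
    = (2 * meeting_formula n 0 k.+1)%N.
  by rewrite -(parityE true) -sum_M_parity.
have NE : \sum_(p \in [set: int]) N_E n.+1 k p
    = (2 * meeting_formula n 0 k.+1)%N.
  rewrite -(parityE false) -sum_M_parity; apply: eq_fsbigr => p _.
  by rewrite /N_E addr0.
split; first by rewrite NO NE.
rewrite NE /=.
have -> : (n.+1%:Z - 1 = n%:Z)%R by lia.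
case: leqP => hkn.
  have -> : (2 * n.+1%:Z - k%:Z - 2 = (n.*2 - k)%N%:Z)%R by lia.
  by rewrite /= addn0 mulnA expnS.
(* Here [n < k], so the upper argument, equal to 2n - k, is negative or less than [n]. *)
rewrite muln0; case E : (2 * _ - _ - _)%R => [i|i] /=; last by rewrite muln0.
by rewrite bin_small ?muln0 //; lia.
Qed.
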